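(* For every integer $t\geq 4$, every graph $G$ that does not contain $K_t$ as a minor is $(2t-2)$-colourable with clustering $\lceil \tfrac{1}{2}(t-2)\rceil$.
   Context: All graphs are finite and simple. A graph $G$ is $k$-colourable with clustering $c$ if each vertex can be assigned one of $k$ colours (not necessarily properly) such that every monochromatic component (a connected component of the subgraph induced by the vertices of one colour) has at most $c$ vertices. *)

(* Defs.v *)
From mathcomp Require Import all_boot.
Set Implicit Arguments.
Unset Strict Implicit.
Unset Printing Implicit Defensive.

Record sgraph := SGraph {
  svertex :> finType;
  adj : rel svertex;
  adj_sym : symmetric adj;
  adj_irrefl : irreflexive adj }.

Section InducedSubgraphs.
Variables (G : sgraph) (A : {set G}).

Definition induced_adj : rel G := [rel x y in A | adj x y].

                                                                               
                                                                          
                                               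
Definition component (x : G) : {set G} := [set y | connect induced_adj x y].

Definition components : {set {set G}} := [set component x | x in A].

                                                                      
Definition connected_in : Prop :=
  A != set0 /\ {in A &, forall x y, connect induced_adj x y}.

End InducedSubgraphs.

                                                                            
                                                                              
                                                                  
Definition minor_model (G H : sgraph) (B : H -> {set G}) : Prop :=
  [/\ forall i, connected_in (B i),
      forall i j, i != j -> [disjoint B i & B j]
    & forall i j, adj i j ->
        exists x y, [/\ x \in B i, y \in B j & adj x y]].

Definition has_minor (G H : sgraph) : Prop :=
  exists B : H -> {set G}, minor_model B.

Definition complete_adj (n : nat) : rel 'I_n := [rel i j | i != j].

Lemma complete_adj_sym n : symmetric (@complete_adj n).
Proof. by move=> i j; rewrite /complete_adj /= eq_sym. Qed.

Lemma complete_adj_irrefl n : irreflexive (@complete_adj n).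
Proof. by move=> i; rewrite /complete_adj /= eqxx. Qed.

Definition complete_graph (n : nat) : sgraph :=
  SGraph (@complete_adj_sym n) (@complete_adj_irrefl n).

Definition colourable_with_clustering (G : sgraph) (k c : nat) : Prop :=
  exists f : G -> 'I_k,
    forall (i : 'I_k) (C : {set G}),
      C \in components [set v | f v == i] -> #|C| <= c.

(* Main.v *)
(** Parts are carved out of the graph one at a time.  If C is a component of
    what remains, the earlier parts with a neighbour in C are connected and
    pairwise adjacent, so together with C they form a clique minor and there
    are at most t-2 of them.  Choose in C a neighbour of each of these parts;
    the next part is a minimal connected subset P of C containing the chosen
    set S.  Colouring the parts greedily takes t-1 colours, and each part is
    split into two sides.  For the latter, a vertex of P outside S is a cut
    vertex of P by minimality, so P decomposes at such vertices until
    everything lies in S, where S is simply halved. *)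

Require Import Defs.
From mathcomp Require Import all_boot zify.
Set Implicit Arguments.
Unset Strict Implicit.
Unset Printing Implicit Defensive.

(** * Connectivity expressed by cuts *)

Section Connectivity.
Variable G : sgraph.
Implicit Types (A B K : {set G}) (x y : G).

Definition anticomplete A B := [forall x in A, forall y in B, ~~ adj x y].

Lemma anticompleteP A B :
  reflect (forall x y, x \in A -> y \in B -> ~~ adj x y) (anticomplete A B).
Proof.
apply: (iffP forall_inP) => [h x y xA yB|h x xA].
  exact: (forall_inP (h x xA)).
by apply/forall_inP => y yB; apply: h.
Qed.

Lemma anticompleteC A B : anticomplete A B = anticomplete B A.
Proof.
by apply/anticompleteP/anticompleteP => h x y xA yB; rewrite adj_sym h.
Qed.

Lemma anticompletePn A B :
  reflect (exists x y, [/\ x \in A, y \in B & adj x y]) (~~ anticomplete A B).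
Proof.
apply: (iffP idP) => [|[x [y [xA yB xy]]]].
  rewrite negb_forall_in => /exists_inP [x xA].
  rewrite negb_forall_in => /exists_inP [y yB /negbNE xy].
  by exists x, y.
by apply/negP => /anticompleteP /(_ x y xA yB); rewrite xy.
Qed.

(* Connectedness by cuts; unlike [connected_in], it holds of the empty set. *)
Definition uncut A :=
  [forall B : {set G}, (B \subset A) && anticomplete B (A :\: B) ==>
     (A \subset B) || (A \subset A :\: B)].

(** The cut to test is [K :&: A] against the rest of [K], which lies in [B]; [A] and [B] may
    overlap. *)
Lemma uncut_subset K A B :
  uncut K -> K \subset A :|: B -> anticomplete A B ->
  K \subset A \/ K \subset B.
Proof.
move=> /forallP /(_ (K :&: A)) + sK /anticompleteP nAB.
rewrite subsetIl /=.
have -> : anticomplete (K :&: A) (K :\: (K :&: A)).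
  apply/anticompleteP => x y /setIP[_ xA] /setDP[yK].
  rewrite inE yK /= => yA; apply: nAB => //.
  by move: (subsetP sK y yK); rewrite inE (negbTE yA).
case/orP => /subsetP h; [left|right]; apply/subsetP => x xK.
  by case/setIP: (h x xK).
case/setDP: (h x xK) => _; rewrite inE xK /= => xA.
by move: (subsetP sK x xK); rewrite inE (negbTE xA).
Qed.

Lemma uncut_intro A :
  (forall B1 B2, A = B1 :|: B2 -> [disjoint B1 & B2] -> anticomplete B1 B2 ->
     A \subset B1 \/ A \subset B2) ->
  uncut A.
Proof.
move=> h; apply/forallP => B; apply/implyP => /andP[sBA nB]; apply/orP.
apply: h nB; first by rewrite setDE setUIr setUCr setIT; apply/esym/setUidPr.
by rewrite -setI_eq0 setIDA setDIl setDv set0I.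
Qed.

Lemma uncutPn A : ~~ uncut A ->
  exists A1 A2, [/\ A = A1 :|: A2, [disjoint A1 & A2], anticomplete A1 A2,
    A1 != set0 & A2 != set0].
Proof.
rewrite negb_forall => /existsP[B].
rewrite negb_imply negb_or => /andP[/andP[sBA nB] /andP[n1 n2]].
exists B, (A :\: B); split=> //.
- by rewrite setDE setUIr setUCr setIT; apply/esym/setUidPr.
- by rewrite -setI_eq0 setIDA setDIl setDv set0I.
- by apply: contraNneq n2 => ->; rewrite setD0.
- by rewrite setD_eq0.
Qed.

Lemma uncutU x A B :
  uncut A -> uncut B -> x \in A -> x \in B -> uncut (A :|: B).
Proof.
move=> uA uB xA xB; apply: uncut_intro => B1 B2 e dis n.
have sA : A \subset B1 :|: B2 by rewrite -e subsetUl.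
have sB : B \subset B1 :|: B2 by rewrite -e subsetUr.
have [hA|hA] := uncut_subset uA sA n; have [hB|hB] := uncut_subset uB sB n.
- by left; rewrite subUset hA.
- by move/subsetP/(_ x xA): hA; rewrite (disjointFl dis) // (subsetP hB).
- by move/subsetP/(_ x xB): hB; rewrite (disjointFl dis) // (subsetP hA).
- by right; rewrite subUset hA.
Qed.

(** If the side [K :&: (x |: A)] could be cut, the piece avoiding [x] would lie in [A], hence have
    no neighbour in [B], and so would already split off from [K]. *)
Lemma uncut_side x K A B :
  uncut K -> x \in K -> K \subset x |: (A :|: B) -> [disjoint A & B] ->
  anticomplete A B -> uncut (K :&: (x |: A)).
Proof.
move=> uK xK sK dAB /anticompleteP nAB; apply: uncut_intro => B1 B2 e dis n.
wlog xB1 : B1 B2 e dis n / x \in B1 => [hw|].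
  have : x \in B1 :|: B2 by rewrite -e inE xK !inE eqxx.
  case/setUP => [|xB]; first exact: hw.
  rewrite [B1 :|: B2]setUC in e; rewrite disjoint_sym in dis.
  rewrite anticompleteC in n.
  by case: (hw B2 B1 e dis n xB); [right|left].
have sB2 y : y \in B2 -> y \in A.
  move=> yB2; have : y \in B1 :|: B2 by rewrite inE yB2 orbT.
  rewrite -e !inE => /andP[_ /orP[/eqP yx|//]].
  by rewrite -yx (disjointFl dis yB2) in xB1.
have n' : anticomplete (B1 :|: B) B2.
  apply/anticompleteP => y z /setUP[yB1|yB] zB2.
    exact: (anticompleteP _ _ n).
  by rewrite adj_sym nAB // sB2.
have s' : K \subset (B1 :|: B) :|: B2.
  apply/subsetP => y yK; case: (boolP (y \in B)) => [yB|yB].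
    by rewrite !inE yB !orbT.
  have : y \in B1 :|: B2.
    rewrite -e inE yK /=; move/subsetP/(_ y yK): sK.
    by rewrite !inE (negbTE yB) orbF.
  by rewrite !inE => /orP[]->; rewrite ?orbT.
have [h|h] := uncut_subset uK s' n'; last first.
  by right; apply: subset_trans h; apply: subsetIl.
left; apply/subsetP => y yK1.
have yK : y \in K by case/setIP: yK1.
move: (yK1); rewrite e => /setUP[//|yB2].
case/setUP: (subsetP h y yK) => // yB.
by move: (sB2 y yB2); rewrite (disjointFl dAB yB).
Qed.

(** No edge inside [A] leaves the set of vertices reachable from [x], so that set is one side of a
    cut and must be all of [A]. *)
Lemma uncut_connected A : A != set0 -> uncut A -> connected_in A.
Proof.
move=> A0 uA; split=> // x y xA yA.
set B1 := [set z in A | connect (induced_adj A) x z].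
have [] := @uncut_subset A B1 (A :\: B1) uA.
- apply/subsetP => z zA; rewrite !inE zA andbT; apply: orbN.
- apply/anticompleteP => u v; rewrite !inE => /andP[uA' cu] /andP[].
  move=> + vA; rewrite vA /=; apply: contra => uv; apply: connect_trans cu _.
  by apply: connect1; rewrite /induced_adj /= uA' vA.
- by move=> /subsetP/(_ y yA); rewrite inE => /andP[].
- by move=> /subsetP/(_ x xA); rewrite !inE xA connect0.
Qed.

Lemma component_subset A x : x \in A -> component A x \subset A.
Proof.
move=> xA; apply/subsetP => y; rewrite inE => cxy.
rewrite -(closed_connect _ cxy) // => u v.
by rewrite /induced_adj /= => /andP[/andP[-> ->]].
Qed.

(** A step inside [A] stays in the component and cannot cross from [B1] to [B2], so membership in
    [B1] is constant along paths from [x]. *)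
Lemma component_uncut A x : uncut (component A x).
Proof.
apply: uncut_intro => B1 B2 e dis /anticompleteP n.
have xC : x \in component A x by rewrite inE connect0.
have inC z : (z \in component A x) = (z \in B1) || (z \in B2).
  by rewrite e inE.
have B1C : closed (induced_adj A) B1.
  apply: intro_closed => [|u v uv uB1].
    apply: sym_connect_sym => u v.
    by rewrite /induced_adj /= adj_sym [(u \in A) && _]andbC.
  have : v \in component A x.
    rewrite inE; apply: connect_trans (connect1 uv).
    by have := inC u; rewrite uB1 inE.
  rewrite inC => /orP[//|vB2]; have := n u v uB1 vB2.
  by case/andP: uv => _ ->.
have st y : y \in component A x -> (x \in B1) = (y \in B1).
  by rewrite inE; apply: closed_connect.
case xB1: (x \in B1); [left|right]; apply/subsetP => y yC.
  by rewrite -st.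
by move: (yC); rewrite inC -st // xB1.
Qed.

End Connectivity.

(** * Monochromatic sets and the halving of a minimal connected set *)

Definition mono (G : sgraph) (T : Type) (f : G -> T) (K : {set G}) :=
  {in K &, forall x y, f x = f y}.

Lemma mono_subset (G : sgraph) (T : Type) (f : G -> T) (K L : {set G}) :
  K \subset L -> mono f L -> mono f K.
Proof. by move=> /subsetP s m x y xK yK; apply: m; apply: s. Qed.

Lemma eq_in_mono (G : sgraph) (T : Type) (f g : G -> T) (K : {set G}) :
  {in K, f =1 g} -> mono f K -> mono g K.
Proof. by move=> e m x y xK yK; rewrite -!e //; apply: m. Qed.

Lemma exists_subset_card (T : finType) (A : {set T}) m :
  m <= #|A| -> exists2 B : {set T}, B \subset A & #|B| = m.
Proof.
move=> mA; exists [set x in take m (enum A)].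
  by apply/subsetP => x; rewrite inE => /mem_take; rewrite mem_enum.
rewrite cardsE (card_uniqP _) ?take_uniq ?enum_uniq //.
by rewrite size_takel // -cardE.
Qed.

(* The smaller bound at the root r is what lets two colourings be glued at a
   cut vertex: one of them is rooted there. *)
Lemma minimal_uncut_bipartition (G : sgraph) (H S : {set G}) (r : G) :
  S \subset H -> r \in S -> uncut H ->
  (forall T : {set G}, T \subset H -> S \subset T -> uncut T -> T = H) ->
  exists f : G -> bool,
    (forall K : {set G}, K \subset H -> uncut K -> mono f K ->
       #|K| <= uphalf #|S|) /\
    (forall K : {set G}, K \subset H -> uncut K -> mono f K -> r \in K ->
       #|K| <= maxn 1 #|S|./2).
Proof.
have [n] := ubnP #|H|; elim: n H S r => // n IH H S r ltn sSH rS uH minH.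
case: (boolP (H \subset S)) => [sHS|].
  have S0 : 0 < #|S| by rewrite card_gt0; apply/set0Pn; exists r.
  have := cardsD1 r S; rewrite rS => eS.
  (* Here [H] is [S], and counting alone suffices: the class of [r] gets exactly [maxn 1 #|S|./2]
     vertices, which leaves at most [uphalf #|S|] for the other. *)
  have [|F sF cF] := @exists_subset_card _ (S :\ r) (maxn 1 #|S|./2).-1.
    by lia.
  have rF : r \notin F.
    by apply/negP => /(subsetP sF); rewrite !inE eqxx.
  have cF' : #|r |: F| = maxn 1 #|S|./2 by rewrite cardsU1 rF cF; lia.
  have sF' : r |: F \subset S.
    by rewrite subUset sub1set rS (subset_trans sF) // subsetDl.
  have bF (K : {set G}) z : mono (mem (r |: F)) K -> z \in K ->
      z \in r |: F -> #|K| <= maxn 1 #|S|./2.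
    move=> mK zK zF; rewrite -cF'; apply/subset_leq_card/subsetP => y yK.
    by have := mK y z yK zK; rewrite /= zF.
  exists (mem (r |: F)); split=> K sK _ mK; last first.
    by move=> rK; apply: bF rK _ => //; rewrite setU11.
  case: (set_0Vmem (K :&: (r |: F))) => [K0|[z /setIP[zK zF]]]; last first.
    by apply: leq_trans (bF K z mK zK zF) _; clear -S0; lia.
  have : #|K| <= #|S :\: (r |: F)|.
    apply/subset_leq_card; rewrite subsetD (subset_trans sK sHS) /=.
    by rewrite -setI_eq0 K0.
  by rewrite cardsD (setIidPr sF') cF'; clear -S0; lia.
case/subsetPn => x xH xS.
have xr : x != r by apply: contraNneq xS => ->.
have : ~~ uncut (H :\ x).
  apply/negP => u; suff : x \in H :\ x by rewrite !inE eqxx.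
  rewrite (minH _ _ _ u) // ?subsetDl //.
  by rewrite subsetD1 sSH.
case/uncutPn => A [B].
wlog rA : A B / r \in A => [hw|].
  case=> e dAB nAB A0 B0.
  have : r \in A :|: B by rewrite -e !inE eq_sym xr (subsetP sSH).
  case/setUP => [rA|rB]; first exact: (hw A B).
  by apply: (hw B A) => //; rewrite setUC disjoint_sym anticompleteC.
case=> e dAB nAB A0 B0.
have eH : H = x |: (A :|: B) by rewrite -e setD1K.
have xAB : x \notin A :|: B by rewrite -e !inE eqxx.
have [xA xB] : x \notin A /\ x \notin B.
  by move: xAB; rewrite inE negb_or => /andP.
(* The cut vertex is kept on both sides and added to both terminal sets; this makes each side
   minimal for its own terminals. *)
pose H1 := x |: A; pose H2 := x |: B.
pose S1 := x |: (S :&: A); pose S2 := x |: (S :&: B).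
have sH1 : H1 \subset H by rewrite eH setUS // subsetUl.
have sH2 : H2 \subset H by rewrite eH setUS // subsetUr.
have dBA : [disjoint B & A] by rewrite disjoint_sym.
have nBA : anticomplete B A by rewrite anticompleteC.
have side1 K : uncut K -> K \subset H -> x \in K -> uncut (K :&: H1).
  by move=> uK sK xK; apply: (@uncut_side G x K A B) => //; rewrite -eH.
have side2 K : uncut K -> K \subset H -> x \in K -> uncut (K :&: H2).
  move=> uK sK xK; apply: (@uncut_side G x K B A) => //.
  by rewrite [B :|: A]setUC -eH.
have uH1 : uncut H1 by rewrite -(setIidPr sH1) side1.
have uH2 : uncut H2 by rewrite -(setIidPr sH2) side2.
have SAB : S \subset x |: (A :|: B) by rewrite -eH.
(* Both sides meet [S], so adding [x] to the terminals makes neither [S1] nor [S2] larger than [S],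
   and both have at least two elements, which makes the [maxn 1] in the root bounds harmless. *)
have SB0 : S :&: B != set0.
  apply: contra_neq B0 => SB; suff eH1 : H1 = H.
    apply/setP => y; rewrite inE; apply/negP => yB.
    have : y \in H1 by rewrite eH1 (subsetP sH2) // !inE yB orbT.
    rewrite !inE (disjointFl dAB yB) orbF => /eqP yx.
    by move: xB; rewrite -yx yB.
  apply: minH => //; apply/subsetP => y yS.
  have /setU1P[->|/setUP[yA|yB]] := subsetP SAB y yS; rewrite ?setU11 //.
    by rewrite !inE yA orbT.
  by have := in_set0 y; rewrite -SB inE yS yB.
have SA0 : S :&: A != set0 by apply/set0Pn; exists r; rewrite inE rS.
have cS : #|S| = #|S :&: A| + #|S :&: B|.
  rewrite -cardsUI -setIUr setIACA setIid.
  move: dAB; rewrite -setI_eq0 => /eqP ->; rewrite setI0 cards0 addn0.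
  congr #|pred_of_set _|; apply/esym/setIidPl/subsetP => y yS.
  have /setU1P[yx|//] := subsetP SAB y yS.
  by move: xS; rewrite -yx yS.
have cS1 : #|S1| = #|S :&: A|.+1.
  by rewrite cardsU1 inE (negbTE xA) andbF.
have cS2 : #|S2| = #|S :&: B|.+1.
  by rewrite cardsU1 inE (negbTE xB) andbF.
move: SA0 SB0; rewrite -!card_gt0 => SA0 SB0.
have cH : #|H| = (#|A| + #|B|).+1.
  rewrite eH cardsU1 xAB add1n -cardsUI.
  by move: dAB; rewrite -setI_eq0 => /eqP ->; rewrite cards0 addn0.
have cA : 0 < #|A| by rewrite card_gt0.
have cB : 0 < #|B| by rewrite card_gt0.
have [||||T sT sST uT|f1 [f1a f1r]] := IH H1 S1 r.
- by rewrite cardsU1 xA; clear -ltn cH cB; lia.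
- by rewrite setUS // subsetIr.
- by rewrite !inE rS rA orbT.
- by [].
- have xT : x \in T by rewrite (subsetP sST) // setU11.
  (* A smaller candidate [T] for [H1], glued to [H2] at [x], would be a smaller candidate for
     [H]. *)
  have eT : T :|: H2 = H.
    apply: minH; last by apply: (@uncutU G x); rewrite ?setU11.
      by rewrite subUset (subset_trans sT).
    apply/subsetP => y yS.
    have /setU1P[->|/setUP[yA|yB]] := subsetP SAB y yS.
    - by rewrite inE xT.
    - by rewrite inE (subsetP sST) // !inE yS yA orbT.
    - by rewrite !inE yB !orbT.
  apply/eqP; rewrite eqEsubset sT; apply/subsetP => y /setU1P[->//|yA].
  have : y \in T :|: H2 by rewrite eT (subsetP sH1) // !inE yA orbT.
  rewrite !inE (disjointFr dAB yA) orbF => /orP[//|/eqP ->].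
  exact: xT.
(* The side without [r] is rooted at the cut vertex, so a piece through [x] obeys the rounded-down
   bound there. *)
have [||||T sT sST uT|f2 [f2a f2r]] := IH H2 S2 x.
- by rewrite cardsU1 xB; clear -ltn cH cA; lia.
- by rewrite setUS // subsetIr.
- by rewrite setU11.
- by [].
- have xT : x \in T by rewrite (subsetP sST) // setU11.
  have eT : T :|: H1 = H.
    apply: minH; last by apply: (@uncutU G x); rewrite ?setU11.
      by rewrite subUset (subset_trans sT).
    apply/subsetP => y yS.
    have /setU1P[->|/setUP[yA|yB]] := subsetP SAB y yS.
    - by rewrite inE xT.
    - by rewrite !inE yA !orbT.
    - by rewrite inE (subsetP sST) // !inE yS yB orbT.
  apply/eqP; rewrite eqEsubset sT; apply/subsetP => y /setU1P[->//|yB].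
  have : y \in T :|: H1 by rewrite eT (subsetP sH2) // !inE yB orbT.
  rewrite !inE (disjointFl dAB yB) orbF => /orP[//|/eqP ->].
  exact: xT.
(* The two colours of [f2] are swapped if necessary so that it agrees with [f1] at [x]. *)
pose f y := if y \in H1 then f1 y else f2 y (+) (f1 x (+) f2 x).
have ff1 (K : {set G}) : K \subset H1 -> mono f K -> mono f1 K.
  by move=> /subsetP sK; apply: eq_in_mono => y yK; rewrite /f sK.
have ff2 (K : {set G}) : K \subset H2 -> mono f K -> mono f2 K.
  move=> /subsetP sK m y z yK zK.
  have fE u : u \in K -> f u = f2 u (+) (f1 x (+) f2 x).
    move=> /sK; rewrite /f !inE; case: eqP => [-> _|_ /= uB].
      by rewrite addbC -addbA addbb addbF.
    by rewrite (disjointFl dAB uB).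
  by have := m y z yK zK; rewrite !fE // => /addIb.
have cK (K : {set G}) : K \subset H -> x \in K ->
    #|K|.+1 = #|K :&: H1| + #|K :&: H2|.
  move=> sK xK; rewrite -cardsUI -setIUr setIACA setIid.
  have -> : H1 :|: H2 = H by rewrite /H1 /H2 -setUUr -eH.
  have -> : H1 :&: H2 = [set x].
    rewrite /H1 /H2 -setUIr; move: dAB; rewrite -setI_eq0 => /eqP ->.
    by rewrite setU0.
  by rewrite (setIidPl sK) (setIidPr _) ?sub1set // cards1 addn1.
have xB2 (K : {set G}) : K \subset H -> uncut K -> mono f K -> x \in K ->
    #|K :&: H2| <= #|S2|./2.
  move=> sK uK mK xK; apply: leq_trans (f2r _ _ _ _ _) _.
  - exact: subsetIr.
  - exact: side2.
  - by apply: ff2; [exact: subsetIr|apply: mono_subset mK; exact: subsetIl].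
  - by rewrite !inE xK eqxx.
  - by clear -cS cS1 cS2 SA0 SB0; lia.
have split (K : {set G}) : K \subset H -> uncut K -> x \notin K ->
    K \subset A \/ K \subset B.
  move=> sK uK xK; apply: uncut_subset => //.
  by rewrite -e subsetD1 sK.
have AH1 : A \subset H1 by apply: subsetUr.
have BH2 : B \subset H2 by apply: subsetUr.
(* If [x] is in [K], the bounds of the two sides are added and one is subtracted because [x] is
   counted twice. This cancels the two extra terminals, as [#|S1| + #|S2| = #|S| + 2]. Rounding up
   occurs on the [H1] side only, and not even there when [r] is in [K]. *)
exists f; split=> K sK uK mK.
  have [xK|xK] := boolP (x \in K).
    have := cK K sK xK; have := xB2 K sK uK mK xK.
    have : #|K :&: H1| <= uphalf #|S1|.
      apply: f1a; [exact: subsetIr|exact: side1|].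
      by apply: ff1; [exact: subsetIr|apply: mono_subset mK; exact: subsetIl].
    by clear -cS cS1 cS2 SA0 SB0; lia.
  have [h|h] := split K sK uK xK.
    have h1 := subset_trans h AH1.
    by have := f1a K h1 uK (ff1 K h1 mK); clear -cS cS1 cS2 SA0 SB0; lia.
  have h2 := subset_trans h BH2.
  by have := f2a K h2 uK (ff2 K h2 mK); clear -cS cS1 cS2 SA0 SB0; lia.
move=> rK.
have [xK|xK] := boolP (x \in K).
  have := cK K sK xK; have := xB2 K sK uK mK xK.
  have : #|K :&: H1| <= maxn 1 #|S1|./2.
    apply: f1r; [exact: subsetIr|exact: side1| |].
    - by apply: ff1; [exact: subsetIr|apply: mono_subset mK; exact: subsetIl].
    - by rewrite !inE rK rA orbT.
  by clear -cS cS1 cS2 SA0 SB0; lia.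
have [h|h] := split K sK uK xK.
  have h1 := subset_trans h AH1.
  by have := f1r K h1 uK (ff1 K h1 mK) rK; clear -cS cS1 cS2 SA0 SB0; lia.
by move/subsetP/(_ r rK): h; rewrite (disjointFr dAB rA).
Qed.

(** * Carving out the parts and colouring them greedily *)

(* Q i is the earlier part of colour i seen by R, or empty. *)
Lemma partition_colouring (n : nat) (G : sgraph) (R : {set G})
    (Q : 'I_n -> {set G}) :
  2 < n -> ~ has_minor G (complete_graph n.+1) ->
  (forall i, uncut (Q i)) ->
  (forall i j, i != j -> [disjoint Q i & Q j]) ->
  (forall i j, i != j -> Q i != set0 -> Q j != set0 ->
     ~~ anticomplete (Q i) (Q j)) ->
  (forall i, [disjoint Q i & R]) ->
  exists f : G -> 'I_n * bool,
    (forall x i, x \in R -> (f x).1 = i -> anticomplete [set x] (Q i)) /\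
    (forall K : {set G}, K \subset R -> uncut K -> mono f K ->
       #|K| <= uphalf n.-1).
Proof.
move=> n2 noM; have [m] := ubnP #|R|.
elim: m R Q => // m IH R Q ltm uQ dQ aQ dQR.
have [R0|Rn0] := eqVneq R set0.
  exists (fun=> (Ordinal (ltnW (ltnW n2)), false)); split=> [x i|K].
    by rewrite R0 inE.
  by rewrite R0 subset0 => /eqP->; rewrite cards0.
have [uR|] := boolP (uncut R); last first.
  case/uncutPn => A [B [e dAB nAB A0 B0]].
  have cR : #|R| = #|A| + #|B|.
    rewrite e -cardsUI; move: dAB; rewrite -setI_eq0 => /eqP->.
    by rewrite cards0 addn0.
  have cA : 0 < #|A| by rewrite card_gt0.
  have cB : 0 < #|B| by rewrite card_gt0.
  have [|||||fA [fA1 fA2]] := IH A Q => //; first by clear -ltm cR cA cB; lia.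
    move=> i; apply: disjointWr (dQR i).
    by rewrite e subsetUl.
  have [|||||fB [fB1 fB2]] := IH B Q => //; first by clear -ltm cR cA cB; lia.
    move=> i; apply: disjointWr (dQR i).
    by rewrite e subsetUr.
  exists (fun x => if x \in A then fA x else fB x); split=> [x i|K sK uK mK].
    rewrite e inE; case: ifP => xA /= xB; first exact: fA1.
    exact: fB1.
  rewrite e in sK; have [h|h] := uncut_subset uK sK nAB.
    apply: fA2 => //; apply: eq_in_mono mK => x xK.
    by rewrite (subsetP h).
  apply: fB2 => //; apply: eq_in_mono mK => x xK.
  by rewrite (disjointFl dAB) // (subsetP h).
pose near i := ~~ anticomplete R (Q i).
have nearQ i : near i -> Q i != set0.
  by case/anticompletePn => x [y [_ yQ _]]; apply/set0Pn; exists y.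
(* If [R] touched every [Q i], these [n] sets and [R], placed at index [ord_max], would model a
   complete minor on [n.+1] vertices. *)
have [i0 far] : exists i0, ~~ near i0.
  apply/existsP; rewrite -negb_forall; apply/negP => /forallP allnear.
  apply: noM; exists (fun j : 'I_n.+1 => oapp Q R (unlift ord_max j)).
  split=> [i|i j|i j].
  - case: unliftP => [k _|_] /=; apply: uncut_connected => //.
    exact: nearQ.
  - case: unliftP => [k ->|->]; case: unliftP => [l ->|->] //= ne.
    + by apply: dQ; apply: contraNneq ne => ->.
    + by rewrite disjoint_sym.
    + by rewrite eqxx in ne.
  - rewrite /= /complete_adj /=.
    case: unliftP => [k ->|->]; case: unliftP => [l ->|->] //= ne;
      apply/anticompletePn.
    + by apply: aQ; rewrite ?nearQ //; apply: contraNneq ne => ->.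
    + by rewrite anticompleteC; apply: allnear.
    + exact: allnear.
    + by rewrite eqxx in ne.
have /set0Pn[x0 x0R] := Rn0.
pose rep i := odflt x0 [pick x in R | ~~ anticomplete [set x] (Q i)].
have repR i : rep i \in R by rewrite /rep; case: pickP => [x /andP[]|].
have repQ i : near i -> ~~ anticomplete [set rep i] (Q i).
  case/anticompletePn => x [y [xR yQ xy]]; rewrite /rep.
  case: pickP => [z /andP[] //|/(_ x)]; rewrite xR /= => /negbFE.
  by move/anticompleteP/(_ x y (set11 x) yQ); rewrite xy.
(* All far colours but [i0] contribute a junk representative, so that S is
   nonempty and has at most n.-1 elements. *)
pose S := [set rep i | i in [set~ i0]].
have sSR : S \subset R by apply/subsetP => x /imsetP[i _ ->].
have cS : #|S| <= n.-1.
  by apply: leq_trans (leq_imset_card _ _) _; rewrite cardsC1 card_ord.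
have [i1 ne1] : exists i1 : 'I_n, i1 != i0.
  have : 0 < #|[set~ i0]| by rewrite cardsC1 card_ord; clear -n2; lia.
  by rewrite card_gt0 => /set0Pn[i1]; rewrite !inE; exists i1.
have rS : rep i1 \in S by apply: imset_f; rewrite !inE.
pose good (T : {set G}) := uncut T && (S \subset T).
(* The next part: containing the representatives keeps it adjacent to every near [Q i], and
   minimality allows it to be halved. *)
have [P /minsetP[/andP[uP sSP] minP] sPR] : {P | minset good P & P \subset R}.
  by apply: minset_exists; rewrite /good uR.
have [T sT sST uT|g [gP _]] := minimal_uncut_bipartition sSP rS uP.
  by apply: minP => //; rewrite /good uT.
have rP : rep i1 \in P by apply: (subsetP sSP).
(* [P] takes the free colour [i0]. Far parts are emptied, since they have no neighbour in [R] and so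
   would break pairwise adjacency with [P]. *)
pose Q' i := if i == i0 then P else if near i then Q i else set0.
have Q'S i : i != i0 -> Q' i != set0 -> near i /\ Q' i = Q i.
  by rewrite /Q' => /negbTE ->; case: ifP; rewrite ?eqxx.
have PQ' i : i != i0 -> Q' i != set0 -> ~~ anticomplete P (Q' i).
  move=> ne q0; have [nr ->] := Q'S i ne q0.
  have /anticompletePn[x [y []]] := repQ i nr.
  rewrite inE => /eqP -> yQ xy; apply/anticompletePn; exists (rep i), y.
  by split=> //; apply/(subsetP sSP)/imset_f; rewrite !inE.
have Q'0 : Q' i0 = P by rewrite /Q' eqxx.
have dPQ' i : i != i0 -> [disjoint P & Q' i].
  rewrite /Q' => /negbTE ->; case: ifP => _; last by rewrite -setI_eq0 setI0.
  by apply: disjointWl sPR _; rewrite disjoint_sym.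
have [|i|i j ne|i j ne|i|f [f1 f2]] := IH (R :\: P) Q'.
- have : #|R :\: P| < #|R|.
    apply: proper_card; rewrite properE subsetDl /=; apply/subsetPn.
    by exists (rep i1); rewrite ?repR // !inE rP.
  by clear -ltm; lia.
- rewrite /Q'; case: ifP => // _; case: ifP => // _.
  by apply: uncut_intro => B1 B2 _ _ _; left; apply: sub0set.
- have [ei|ni] := eqVneq i i0.
    by rewrite ei Q'0; apply: dPQ'; rewrite -ei eq_sym.
  have [ej|nj] := eqVneq j i0.
    by rewrite ej Q'0 disjoint_sym; apply: dPQ'.
  rewrite /Q' (negbTE ni) (negbTE nj).
  case: ifP => _; case: ifP => _; rewrite -setI_eq0 ?setI0 ?set0I //.
  by rewrite setI_eq0 dQ.
- have [ei|ni] := eqVneq i i0.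
    by rewrite ei Q'0 => _; apply: PQ'; rewrite -ei eq_sym.
  have [ej|nj] := eqVneq j i0.
    by rewrite ej Q'0 => q0 _; rewrite anticompleteC; apply: PQ'.
  move=> qi qj; have [nri ei] := Q'S i ni qi; have [nrj ej] := Q'S j nj qj.
  by rewrite ei ej; apply: aQ => //; apply: nearQ.
- rewrite -setI_eq0 /Q'; case: ifP => _.
    by rewrite setIDA setDIl setDv set0I.
  case: ifP => _; rewrite ?set0I // setI_eq0.
  by apply: disjointWr (dQR i); apply: subsetDl.
have farQ x : x \in R -> anticomplete [set x] (Q i0).
  move=> xR; apply/anticompleteP => u y; rewrite inE => /eqP -> yQ.
  by move: far => /negbNE/anticompleteP/(_ x y xR yQ).
exists (fun x => if x \in P then (i0, g x) else f x); split.
  move=> x i xR; case: ifP => [_ <-|xP] /=; first exact: farQ.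
  move=> fi; have [->|ni] := eqVneq i i0; first exact: farQ.
  have := f1 x i; rewrite inE xP xR /Q' (negbTE ni) => /(_ isT fi).
  (* For a colour whose part was emptied, the recursive colouring says nothing, but that part has no
     neighbour in [R] at all. *)
  case: ifP => // /negbFE nr _; apply/anticompleteP => u y.
  by rewrite inE => /eqP -> yQ; apply: (anticompleteP _ _ nr).
move=> K sK uK mK.
have fP x : x \in R -> x \notin P -> (f x).1 = i0 -> anticomplete [set x] P.
  by move=> xR xP /(f1 x i0); rewrite Q'0; apply; rewrite inE xP.
(* A monochromatic [K] meeting [P] has first colour [i0] throughout, and vertices of that colour
   outside [P] have no neighbour in [P]. *)
have [h|] : K \subset P \/ K \subset R :\: P.
- case: (set_0Vmem (K :&: P)) => [K0|[z /setIP[zK zP]]].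
    by right; rewrite subsetD sK -setI_eq0 K0 eqxx.
  left; have [||//|h] := @uncut_subset G K P (K :\: P) uK.
  + by apply/subsetP => y yK; rewrite !inE yK andbT; apply: orbN.
  + rewrite anticompleteC; apply/anticompleteP => y u /setDP[yK yP] uP'.
    have : (f y).1 = i0.
      by have := mK y z yK zK; rewrite (negbTE yP) zP => ->.
    move/(fP y (subsetP sK y yK) yP)/anticompleteP/(_ y u); apply=> //.
    exact: set11.
  + by move/subsetP/(_ z zK): h; rewrite inE zP.
- apply: leq_trans (gP K h uK _) _; last by clear -cS; lia.
  move=> x y xK yK; have := mK x y xK yK.
  by rewrite !(subsetP h) // => -[].
- move=> h; apply: f2 => //; apply: eq_in_mono mK => x xK.
  by case/setDP: (subsetP h x xK) => _ /negbTE ->.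
Qed.

(** * From part colours and sides to a clustered colouring of the whole graph *)

Theorem theorem1 (t : nat) (ht : 4 <= t) (G : sgraph)
  (hG : ~ has_minor G (complete_graph t)) :
  colourable_with_clustering G (2 * t - 2) (uphalf (t - 2)).
Proof.
(* With [n] equal to [t - 1], the pairs of a part colour and a side number [2 * n], and [t - 2]
   becomes [n.-1]. Carving starts from the whole vertex set with every earlier part empty. *)
case: t ht hG => // n n2 hG.
have u0 : uncut (set0 : {set G}).
  by apply: uncut_intro => B1 B2 _ _ _; left; apply: sub0set.
have [||||||f [_ fK]] := @partition_colouring n G setT (fun=> set0) => //.
- by move=> i j _; rewrite -setI_eq0 setI0.
- by move=> i j _; rewrite eqxx.
- by move=> i; rewrite -setI_eq0 set0I.
have card_col : #|{: 'I_n * bool}| = 2 * n.+1 - 2.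
  by rewrite card_prod card_ord card_bool; lia.
exists (fun x => cast_ord card_col (enum_rank (f x))) => i C.
case/imsetP => x xA ->; set A := [set v | _] in xA *.
have -> : n.+1 - 2 = n.-1 by lia.
apply: fK; [exact: subsetT|exact: component_uncut|].
apply: (mono_subset (component_subset xA)) => y z; rewrite !inE.
by move=> /eqP <- /eqP /cast_ord_inj /enum_rank_inj.
Qed.
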